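(* Shkarin's class $\mathcal{M}$ consists of all finite metric spaces of strict $2$-negative type. That is, for every integer $n > 1$, an $(n+1)$-point metric space belongs to $\mathcal{M}$ if and only if it has strict $2$-negative type.
   Context: $\mathcal{M}$ denotes the class of all finite metric spaces $(X,d)$, $X = \{x_0, x_1, \ldots, x_n\}$ with $n > 1$ (and $x_0,\ldots,x_n$ distinct), which admit an isometric (distance-preserving) embedding $\phi : X \to \ell_2$ such that the vectors $\phi(x_j) - \phi(x_0)$, $1 \le j \le n$, are linearly independent. Here $\ell_2$ is the real Hilbert space of square-summable sequences. A metric space $(X,d)$ has strict $2$-negative type if for all finite subsets $\{z_1, \ldots, z_m\} \subseteq X$ (with $z_1,\ldots,z_m$ distinct) and all real numbers $\eta_1, \ldots, \eta_m$, not all zero, with $\eta_1 + \cdots + \eta_m = 0$, we have $\sum_{1 \le i,j \le m} d(z_i,z_j)^2 \eta_i \eta_j < 0$. *)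

(* Defs.v *)
From HB Require Import structures.
From mathcomp Require Import all_boot all_order all_algebra.
From mathcomp Require Import all_classical all_reals all_analysis.

Set Implicit Arguments.
Unset Strict Implicit.
Unset Printing Implicit Defensive.

Import Order.TTheory GRing.Theory Num.Theory.
Import numFieldNormedType.Exports.

Local Open Scope classical_set_scope.
Local Open Scope ring_scope.

(* [LfunType] consists of functions, not almost-everywhere classes, and every
   set of natural numbers is measurable: this is exactly the vector space of
   square-summable real sequences, with pointwise operations, as checked by
   [mem_ell2E] and [ell2_subE] below. *)
Notation ell2 R := (LfunType (@counting nat R) (@lee1n R 2)).

(* Extended-real valued because [Lnorm] is; it is finite on [ell2]. *)
Definition ell2_norm (R : realType) (u : ell2 R) : \bar R :=
  'N[@counting nat R]_2%:E[EFin \o u]%E.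

Lemma ell2_normE (R : realType) (u : ell2 R) :
  ell2_norm u = ((\sum_(k <oo) (u k ^+ 2)%:E) `^ 2^-1)%E.
Proof.
rewrite /ell2_norm Lnorm_counting//; congr (_ `^ _)%E.
by apply: eq_eseriesr => k _ /=; rewrite powR_mulrn// real_normK// num_real.
Qed.

Lemma mem_ell2E (R : realType) (f : nat -> R) :
  (exists u : ell2 R, u =1 f) <-> (\sum_(k <oo) (f k ^+ 2)%:E < +oo)%E.
Proof.
have normE : 'N[@counting nat R]_2%:E[EFin \o f]%E =
    ((\sum_(k <oo) (f k ^+ 2)%:E) `^ 2^-1)%E.
  rewrite Lnorm_counting//; congr (_ `^ _)%E.
  by apply: eq_eseriesr => k _ /=; rewrite powR_mulrn// real_normK// num_real.
split=> [[u /funext uf]|fS].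
  have := @Lfunction_finite _ _ _ _ _ _ u; rewrite uf /finite_norm normE => ?.
  by rewrite (@lty_poweRy _ _ 2^-1)// gt_eqF.
have fL : f \in Lfun (@counting nat R) 2%:E.
  by rewrite inE; apply/andP; split; rewrite inE//= /finite_norm normE poweR_lty.
by exists (Lfun_Sub (@lee1n R 2) fL).
Qed.

Lemma ell2_subE (R : realType) (u v : ell2 R) k : (u - v) k = u k - v k.
Proof. by []. Qed.

Definition isometric_embedding (R : realType) (X : metricType R)
    (phi : X -> ell2 R) : Prop :=
  forall x y : X, ell2_norm (phi x - phi y) = (mdist x y)%:E.

Definition linearly_independent (R : realType) (V : lmodType R) (n : nat)
    (v : 'I_n -> V) : Prop :=
  forall c : 'I_n -> R, \sum_(j < n) c j *: v j = 0 -> forall j, c j = 0.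

Definition shkarin_class (R : realType) (X : metricType R) : Prop :=
  exists n : nat, (1 < n)%N /\
  exists x : 'I_n.+1 -> X, bijective x /\
  exists phi : X -> ell2 R, isometric_embedding phi /\
    linearly_independent
      (fun j : 'I_n => phi (x (lift ord0 j)) - phi (x ord0)).

Definition strict_2_negative_type (R : realType) (X : metricType R) : Prop :=
  forall (m : nat) (z : 'I_m -> X) (eta : 'I_m -> R),
    injective z ->
    (exists i, eta i != 0) ->
    \sum_(i < m) eta i = 0 ->
    \sum_(i < m) \sum_(j < m) mdist (z i) (z j) ^+ 2 * eta i * eta j < 0.

(* Main.v *)
Require Import Defs.
From mathcomp Require Import all_boot all_order all_algebra.
From mathcomp Require Import all_classical all_reals all_analysis.
From mathcomp Require Import ring.

(** Everything rests on one identity.  If the weights [e i] add up to zero,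
    any part of [h i j] that depends on [i] alone or on [j] alone contributes
    nothing to the double sum of [h i j * e i * e j] ([sum_balanced]).  Applied to the expansion of
    a squared distance between points of a Hilbert space, this leaves minus
    twice the squared norm of the weighted sum of the points ([sum_sqr_diff]).

    Suppose the space embeds with [phi x_j - phi x_0] linearly independent.
    A balanced weighted sum of the [phi x_i] is then nonzero unless every
    weight vanishes ([balanced_sum_neq0]), so the quadratic form of the squared
    distances is negative.  The identity is used one coordinate at a time:
    partial sums of squared coordinates converge to squared distances
    ([ell2_norm_cvg]), and a nonzero coordinate of the weighted sum keeps the
    limit away from zero.

    Conversely, let [d] be of strict 2-negative type and consider, as in
    Schoenberg's theorem, the matrix of the numbers
    [(d(x_0,x_i)^2 + d(x_0,x_j)^2 - d(x_i,x_j)^2) / 2], which are the inner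
    products that the vectors [phi x_i - phi x_0] would have to have.  The same
    identity shows that it is positive definite ([posdef_gram]).  It thus
    factors as [A *m A^T] ([cholesky]); the rows of [A], with [0] for [x_0],
    have the required distances, and they are independent because the
    matrix is definite. *)

Set Implicit Arguments.
Unset Strict Implicit.
Unset Printing Implicit Defensive.

Import Order.TTheory GRing.Theory Num.Theory.
Import numFieldNormedType.Exports.

Local Open Scope classical_set_scope.
Local Open Scope ring_scope.

(** * Balanced quadratic sums *)

(** The terms in [f] and [g] each contain the factor [\sum_i e i]. *)
Lemma sum_balanced (R : comPzRingType) (I : finType) (e f g : I -> R)
    (h : I -> I -> R) :
  \sum_i e i = 0 ->
  \sum_i \sum_j (f i + g j - h i j) * e i * e j =
    - \sum_i \sum_j h i j * e i * e j.
Proof.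
move=> e0.
have -> : \sum_i \sum_j (f i + g j - h i j) * e i * e j =
    (\sum_i f i * e i) * (\sum_j e j) + (\sum_i e i) * (\sum_j g j * e j)
    - \sum_i \sum_j h i j * e i * e j.
  rewrite !mulr_suml -big_split/= -sumrB; apply: eq_bigr => i _.
  rewrite !mulr_sumr -big_split/= -sumrB; apply: eq_bigr => j _; ring.
by rewrite e0 mulr0 mul0r !add0r.
Qed.

Lemma sum_sqr_diff (R : comPzRingType) (I : finType) (e a : I -> R) :
  \sum_i e i = 0 ->
  \sum_i \sum_j (a i - a j) ^+ 2 * e i * e j = - ((\sum_i e i * a i) ^+ 2 *+ 2).
Proof.
move=> /(sum_balanced (fun i => a i ^+ 2) (fun i => a i ^+ 2)
  (fun i j => a i * a j *+ 2)) H.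
under eq_bigr do under eq_bigr do rewrite sqrrB addrAC.
rewrite H; congr (- _).
rewrite expr2 mulr_suml -sumrMnl; apply: eq_bigr => i _.
rewrite mulr_sumr -sumrMnl; apply: eq_bigr => j _; ring.
Qed.

(** * Positive definite matrices *)

Definition posdef (R : numDomainType) n (G : 'M[R]_n) :=
  forall v : 'rV[R]_n, v != 0 -> 0 < (v *m G *m v^T) 0 0.

(** Induction on the size, splitting off the first row and column: the Schur
    complement of the corner is positive definite again. *)
Lemma cholesky (R : rcfType) n (G : 'M[R]_n) :
  G^T = G -> posdef G -> exists A : 'M[R]_n, G = A *m A^T.
Proof.
elim: n G => [|n IH] G; first by exists 0; apply/matrixP => -[].
rewrite -[n.+1]/(1 + n)%N in G *.
rewrite -[G]submxK.
set a := ulsubmx G; set b := dlsubmx G; set C := drsubmx G.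
rewrite tr_block_mx => /eq_block_mx[_ <- _ trC] pdG.
have aE : a = (a 0 0)%:M by exact: mx11_scalar.
set al := a 0 0 in aE.
have al0 : 0 < al.
  have := pdG (row_mx 1%:M 0).
  rewrite tr_row_mx mul_row_block mul_row_col !(mul0mx, trmx0, mulmx0, addr0).
  rewrite mul1mx trmx1 mulmx1; apply.
  by rewrite -row_mx0; apply/eqP => /eq_row_mx[/matrixP/(_ 0 0)/eqP];
    rewrite !mxE oner_eq0.
pose S := C - al^-1 *: (b *m b^T).
have [|v v0|B SE] := IH S.
- by rewrite /S linearB/= trC linearZ/= trmx_mul trmxK.
- (* The first entry of this vector is the one that minimizes the form. *)
  have := pdG (row_mx (- al^-1 *: (v *m b)) v).
  rewrite tr_row_mx mul_row_block mul_row_col aE -scalemxAl mul_mx_scalar.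
  rewrite scalerA mulNr mulVf ?gt_eqF// scaleN1r addNr mul0mx add0r.
  rewrite /S mulmxBr -scalemxAl -scalemxAr mulmxA !scaleNr addrC; apply.
  by rewrite -row_mx0; apply: contraNneq v0 => /eq_row_mx[_ ->].
pose be := Num.sqrt al.
have be0 : be != 0 by rewrite gt_eqF// sqrtr_gt0.
have be2 : be * be = al by rewrite -expr2 sqr_sqrtr// ltW.
exists (block_mx be%:M 0 (be^-1 *: b) B).
rewrite tr_block_mx mulmx_block !(trmx0, mul0mx, mulmx0, addr0).
rewrite tr_scalar_mx -SE -scalar_mxM be2 -aE.
rewrite linearZ/= mul_scalar_mx scalerA mulfV// scale1r.
rewrite mul_mx_scalar scalerA mulfV// scale1r -scalemxAl -scalemxAr scalerA.
by rewrite -invfM be2 /S addrC subrK.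
Qed.

Lemma mulmx_formE (R : comPzRingType) n (G : 'M[R]_n) (v : 'rV_n) :
  (v *m G *m v^T) 0 0 = \sum_i \sum_j G i j * v 0 i * v 0 j.
Proof.
rewrite exchange_big/= mxE; apply: eq_bigr => j _; rewrite !mxE mulr_suml.
by apply: eq_bigr => i _; ring.
Qed.

(** The inner product of [p_i - p_0] and [p_j - p_0], for points [p_i] at
    squared distances [D i j]. *)
Definition gram (R : fieldType) n (D : 'I_n.+1 -> 'I_n.+1 -> R) i j : R :=
  (D ord0 i + D ord0 j - D i j) / 2.

(** A row vector [c] becomes a balanced family of weights once [ord0] is given
    the weight [- \sum_j c j], and [gram] vanishes on row and column [ord0]. *)
Lemma posdef_gram (R : realFieldType) n (D : 'I_n.+1 -> 'I_n.+1 -> R) :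
  (forall i, D i i = 0) -> (forall i j, D i j = D j i) ->
  (forall e : 'I_n.+1 -> R, (exists i, e i != 0) -> \sum_i e i = 0 ->
     \sum_i \sum_j D i j * e i * e j < 0) ->
  posdef (\matrix_(i < n, j < n) gram D (lift ord0 i) (lift ord0 j)).
Proof.
move=> D0 Dsym negD v /rV0Pn[k vk0].
pose e i := if unlift ord0 i is Some j then v 0 j else - \sum_j v 0 j.
have e0 : \sum_i e i = 0.
  rewrite big_ord_recl {1}/e unlift_none addrC; apply/eqP; rewrite subr_eq0.
  by apply/eqP; apply: eq_bigr => i _; rewrite /e liftK.
have ek : exists i, e i != 0 by exists (lift ord0 k); rewrite /e liftK.
have {negD} := negD e ek e0.
have DE i j : D i j = D ord0 i + D ord0 j - gram D i j * 2.
  by rewrite /gram divfK ?pnatr_eq0//; ring.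
under eq_bigr do under eq_bigr do rewrite DE.
rewrite (sum_balanced (D ord0) (D ord0) _ e0) oppr_lt0.
have g0 j : gram D ord0 j = 0 by rewrite /gram D0 add0r subrr mul0r.
have g0' j : gram D j ord0 = 0 by rewrite /gram D0 addr0 Dsym subrr mul0r.
rewrite big_ord_recl big1 ?add0r => [|j _]; last by rewrite g0 !mul0r.
under eq_bigr do rewrite big_ord_recl g0' !mul0r add0r.
suff -> : (v *m (\matrix_(i < n, j < n) gram D (lift ord0 i) (lift ord0 j))
    *m v^T) 0 0 = 2^-1 *
    \sum_(i < n) \sum_(j < n) gram D (lift ord0 i) (lift ord0 j) * 2 *
      e (lift ord0 i) * e (lift ord0 j).
  by move=> H; rewrite mulr_gt0 ?invr_gt0 ?ltr0n.
rewrite mulmx_formE mulr_sumr; apply: eq_bigr => i _.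
rewrite mulr_sumr; apply: eq_bigr => j _.
by rewrite /e !liftK mxE; field.
Qed.

(** Schoenberg's embedding in finite dimension: [gram] is a Gram matrix. *)
Lemma euclidean_embedding (R : realType) n (D : 'I_n.+1 -> 'I_n.+1 -> R) :
  (forall i, D i i = 0) -> (forall i j, D i j = D j i) ->
  (forall e : 'I_n.+1 -> R, (exists i, e i != 0) -> \sum_i e i = 0 ->
     \sum_i \sum_j D i j * e i * e j < 0) ->
  exists p : 'I_n.+1 -> 'rV[R]_n,
    (forall i j, \sum_k (p i - p j) 0 k ^+ 2 = D i j) /\
    linearly_independent (fun j : 'I_n => p (lift ord0 j) - p ord0).
Proof.
move=> D0 Dsym negD.
have pdG := posdef_gram D0 Dsym negD.
set G := (X in posdef X) in pdG.
have [|A GE] := cholesky _ pdG.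
  by apply/matrixP => i j; rewrite !mxE /gram (Dsym (lift ord0 j));
    rewrite [X in X - _]addrC.
pose p i := if unlift ord0 i is Some j then row j A else 0.
exists p; split.
  have pE i j : \sum_k p i 0 k * p j 0 k = gram D i j.
    rewrite /p; case: (unliftP ord0 i) => [i' ->|->]; last first.
      by rewrite big1 => [|k _]; rewrite /gram ?D0 ?add0r ?subrr ?mul0r// mxE
        mul0r.
    case: (unliftP ord0 j) => [j' ->|->]; last first.
      by rewrite big1 => [|k _]; rewrite /gram ?D0 ?addr0 1?Dsym ?subrr ?mul0r//
        [X in _ * X]mxE mulr0.
    have /matrixP/(_ i' j') := GE; rewrite !mxE => ->.
    by apply: eq_bigr => k _; rewrite !mxE.
  move=> i j.
  have -> : D i j = gram D i i + gram D j j - gram D i j * 2.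
    by rewrite /gram !D0; field.
  rewrite -!pE mulr_suml -big_split -sumrB/=; apply: eq_bigr => k _.
  by rewrite !mxE; ring.
move=> c c0 j.
pose v := \row_j c j.
have vA : v *m A = 0.
  rewrite -c0; apply/rowP => k; rewrite !mxE summxE; apply: eq_bigr => i _.
  by rewrite /p liftK unlift_none subr0 !mxE.
have [v0|/pdG] := eqVneq v 0; first by have /rowP/(_ j) := v0; rewrite !mxE.
by rewrite GE mulmxA vA !mul0mx mxE ltxx.
Qed.

(** * Norms in the sequence space *)

Lemma ell2_sumE (R : realType) n (c : 'I_n -> R) (v : 'I_n -> ell2 R) k :
  (\sum_j c j *: v j) k = \sum_j c j * v j k.
Proof. by elim/big_ind2 : _ => // u x w y <- <-. Qed.

Lemma ell2_norm_cvg (R : realType) (u : ell2 R) (r : R) :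
  ell2_norm u = r%:E -> (fun N => \sum_(0 <= k < N) u k ^+ 2) @ \oo --> r ^+ 2.
Proof.
rewrite ell2_normE => ur.
have S0 : (0 <= \sum_(k <oo) (u k ^+ 2)%:E)%E.
  by apply: nneseries_ge0 => k _ _; rewrite lee_fin sqr_ge0.
have SE : (\sum_(k <oo) (u k ^+ 2)%:E = (r ^+ 2)%:E)%E.
  move: S0 ur; case: (\sum_(k <oo) _)%E => [s|_|//]; last by rewrite poweRyr.
  rewrite lee_fin poweR_EFin => s0 [<-].
  by rewrite powR12_sqrt// sqr_sqrtr.
have : (fun N => (\sum_(0 <= k < N) u k ^+ 2)%:E) @ \oo --> (r ^+ 2)%:E.
  rewrite -SE; under eq_fun do rewrite -sumEFin.
  by apply: is_cvg_nneseries => k _ _; rewrite lee_fin sqr_ge0.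
by move=> /fine_cvgP[].
Qed.

Definition pad (R : pzRingType) n (a : 'rV[R]_n) (k : nat) : R :=
  oapp (a 0) 0 (insub k).

Lemma padE (R : pzRingType) n (a : 'rV[R]_n) (i : 'I_n) : pad a i = a 0 i.
Proof. by rewrite /pad valK. Qed.

Lemma padB (R : pzRingType) n (a b : 'rV[R]_n) k :
  pad (a - b) k = pad a k - pad b k.
Proof. by rewrite /pad; case: insub => [i|]/=; rewrite ?mxE ?subr0. Qed.

Lemma pad_series (R : realType) n (a : 'rV[R]_n) :
  (\sum_(k <oo) (pad a k ^+ 2)%:E = (\sum_i a 0 i ^+ 2)%:E)%E.
Proof.
rewrite (nneseries_split 0 n) => [|k _]; last by rewrite lee_fin sqr_ge0.
rewrite add0n eseries0 ?adde0 => [|k nk _]; last first.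
  by rewrite /pad insubN ?expr0n//= -leqNgt.
by rewrite big_mkord sumEFin; under eq_bigr do rewrite padE.
Qed.

Lemma pad_ell2 (R : realType) n (a : 'rV[R]_n) : exists u : ell2 R, u =1 pad a.
Proof. by apply/mem_ell2E; rewrite pad_series ltry. Qed.

(** * The two implications *)

(** A balanced relation between the points [psi (f i)] extends by zero weights
    to all the [psi y]; subtracting [psi ord0] from every point then turns it
    into a linear relation between the differences. *)
Lemma balanced_sum_neq0 (R : realType) (V : lmodType R) n m
    (psi : 'I_n.+1 -> V) (f : 'I_m -> 'I_n.+1) (eta : 'I_m -> R) :
  linearly_independent (fun j : 'I_n => psi (lift ord0 j) - psi ord0) ->
  injective f -> (exists i, eta i != 0) -> \sum_i eta i = 0 ->
  \sum_i eta i *: psi (f i) != 0.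
Proof.
move=> free_psi f_inj [i0 i0N] eta0; apply/eqP => rel.
pose e y := \sum_(i | f i == y) eta i.
have e0 : \sum_y e y = 0 by rewrite -[RHS]eta0 [RHS](partition_big f xpredT).
have erel : \sum_y e y *: psi y = 0.
  rewrite -[RHS]rel [RHS](partition_big f xpredT)//; apply: eq_bigr => y _.
  by rewrite scaler_suml; apply: eq_bigr => i /eqP->.
have e_lift j : e (lift ord0 j) = 0.
  move: j; apply: free_psi.
  under eq_bigr do rewrite scalerBr.
  rewrite sumrB -scaler_suml.
  have /eqP := e0; rewrite big_ord_recl addrC addr_eq0 => /eqP->.
  by rewrite scaleNr opprK addrC -[RHS]erel big_ord_recl.
have e_ord0 : e ord0 = 0.
  by move: e0; rewrite big_ord_recl [X in _ + X]big1 ?addr0.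
have : e (f i0) = 0 by case: (unliftP ord0 (f i0)) => [j|] ->.
rewrite /e (big_pred1 i0) => [/eqP|i]; first exact/negP.
by rewrite (inj_eq f_inj).
Qed.

(** Some coordinate [w k] of the weighted sum is nonzero, and all the partial
    sums past it are bounded above by [- 2 * w k ^+ 2]. *)
Lemma shkarin_class_strict_2_negative_type (R : realType) (X : metricType R) :
  shkarin_class X -> strict_2_negative_type X.
Proof.
move=> [n [_ [x [[g gx xg] [phi [isom free_phi]]]]]] m z eta z_inj eta_neq0 eta0.
pose f i := g (z i).
have fz i : x (f i) = z i by rewrite /f xg.
have f_inj : injective f by move=> i j fij; apply: z_inj; rewrite -!fz fij.
have := balanced_sum_neq0 (psi := phi \o x) free_phi f_inj eta_neq0 eta0.
set w : ell2 R := \sum_i _ => w0.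
have wE k : w k = \sum_i eta i * phi (z i) k.
  by rewrite /w ell2_sumE; apply: eq_bigr => i _; rewrite /= fz.
have [k wk0] : exists k, w k != 0.
  apply: contrapT => H; move/eqP: w0; apply; apply/LfuneqP => k.
  by apply/eqP/negPn/negP => wk; apply: H; exists k.
pose d N i j := \sum_(0 <= l < N) (phi (z i) - phi (z j)) l ^+ 2.
have d_cvg : (fun N => \sum_(i < m) \sum_(j < m) d N i j * eta i * eta j) @ \oo
    --> \sum_(i < m) \sum_(j < m) mdist (z i) (z j) ^+ 2 * eta i * eta j.
  do 2 (apply: cvg_big => [|? _]; first exact: add_continuous).
  by do 2 apply: cvgMl; exact/ell2_norm_cvg/isom.
have dE N : \sum_(i < m) \sum_(j < m) d N i j * eta i * eta j =
    - ((\sum_(0 <= l < N) w l ^+ 2) *+ 2).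
  rewrite -sumrMnl -sumrN.
  under [RHS]eq_bigr do rewrite wE -(sum_sqr_diff _ eta0).
  rewrite [RHS]exchange_big; apply: eq_bigr => i _.
  rewrite [RHS]exchange_big; apply: eq_bigr => j _.
  by rewrite /d !mulr_suml.
have wk_gt0 : 0 < w k ^+ 2 *+ 2 by rewrite pmulrn_lgt0// exprn_even_gt0.
apply: (@le_lt_trans _ _ (- (w k ^+ 2 *+ 2))); last by rewrite oppr_lt0.
apply: (cvgr_to_le d_cvg); exists k.+1 => // N /= kN.
rewrite dE lerN2 ler_pMn2r// (big_nat_widenl _ 0)// (bigD1_seq k) ?iota_uniq//=.
  by rewrite lerDl sumr_ge0// => l _; rewrite sqr_ge0.
by rewrite mem_index_iota.
Qed.

Lemma strict_2_negative_type_shkarin_class (R : realType) (X : metricType R) n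
    (x : 'I_n.+1 -> X) :
  (1 < n)%N -> bijective x -> strict_2_negative_type X -> shkarin_class X.
Proof.
move=> n1 x_bij negX; have [g gx xg] := x_bij.
pose D i j := mdist (x i) (x j) ^+ 2.
have [| | |p [pD free_p]] := @euclidean_embedding R n D.
- by move=> i; rewrite /D mdistxx expr0n.
- by move=> i j; rewrite /D metric_sym.
- by move=> e; apply: negX; exact: bij_inj.
have [phi phiE] : exists phi : X -> ell2 R, forall y, phi y =1 pad (p (g y)).
  by have /choice[phi] := fun y => pad_ell2 (p (g y)); exists phi.
exists n; split=> //; exists x; split=> //; exists phi; split.
  move=> y y'; rewrite ell2_normE.
  under eq_eseriesr do rewrite ell2_subE !phiE -padB.
  rewrite pad_series pD poweR_EFin powR12_sqrt ?sqr_ge0//.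
  by rewrite sqrtr_sqr ger0_norm ?mdist_ge0// !xg.
move=> c c0; apply: free_p; apply/rowP => k.
have /LfuneqP/(_ k) := c0.
rewrite ell2_sumE !mxE summxE => ck; apply: etrans ck; apply: eq_bigr => j _.
by rewrite ell2_subE !phiE !gx !padE !mxE.
Qed.

Local Open Scope card_scope.

Lemma card_eq_ordinal (T : Type) n :
  [set: T] #= `I_n -> exists x : 'I_n -> T, bijective x.
Proof.
move=> /card_set_bijP[f [fun_f inj_f surj_f]].
pose g y : 'I_n := Ordinal (fun_f y I).
suff [x gx xg] : bijective g by exists x; exists g.
rewrite -setTT_bijective; split => //.
- by move=> y y' _ _ [fy]; apply: inj_f; rewrite ?inE.
- by move=> i _; have [y _ fy] := surj_f i (ltn_ord i); exists y => //; apply/val_inj.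
Qed.

Theorem corollary5p7 (R : realType) (n : nat) (X : metricType R)
    (n_gt1 : (1 < n)%N) (cardX : [set: X] #= `I_n.+1) :
  shkarin_class X <-> strict_2_negative_type X.
Proof.
split; first exact: shkarin_class_strict_2_negative_type.
have [x x_bij] := card_eq_ordinal cardX.
exact: strict_2_negative_type_shkarin_class x_bij.
Qed.
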